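(* Let $d\in\mathbb{N}$. The maximal ideal space $M_{A_{\mathrm{sym}}(\mathbb{D}^d)}$ of $A_{\mathrm{sym}}(\mathbb{D}^d)$, with the Gelfand topology, is contractible.
   Context: $\mathbb{N}=\{1,2,3,\dots\}$, $\mathbb{D}=\{z\in\mathbb{C}:|z|<1\}$, and $\overline{\mathbb{D}}$ is its closure in $\mathbb{C}$. For $d\in\mathbb{N}$, $A(\mathbb{D}^d)$ is the polydisc algebra of all functions $f:\overline{\mathbb{D}}^d\to\mathbb{C}$ that are holomorphic in $\mathbb{D}^d$ and continuous on $\overline{\mathbb{D}}^d$, a Banach algebra with pointwise operations and the norm $\|f\|_\infty=\sup_{\mathbf{z}\in\mathbb{D}^d}|f(\mathbf{z})|$. The symmetric group $S_d$ of all permutations of $\{1,\dots,d\}$ acts by $\sigma\mathbf{z}=(z_{\sigma(1)},\dots,z_{\sigma(d)})$ for $\mathbf{z}=(z_1,\dots,z_d)\in\mathbb{C}^d$. A function $f\in A(\mathbb{D}^d)$ is symmetric if $f(\sigma\mathbf{z})=f(\mathbf{z})$ for all $\mathbf{z}\in\mathbb{D}^d$ and all $\sigma\in S_d$. $A_{\mathrm{sym}}(\mathbb{D}^d)$ is the Banach subalgebra of $A(\mathbb{D}^d)$ consisting of all symmetric functions in $A(\mathbb{D}^d)$. The maximal ideal space $M_{\mathcal{A}}$ of a complex unital commutative Banach algebra $\mathcal{A}$ is the set of all nontrivial (nonzero) complex homomorphisms $\varphi:\mathcal{A}\to\mathbb{C}$; its Gelfand topology is the topology induced from the weak-$*$ topology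 of the dual space of $\mathcal{A}$. A topological space $X$ is contractible if there exist $x_0\in X$ and a continuous map $H:[0,1]\times X\to X$ (product topology on $[0,1]\times X$) such that $H(0,x)=x$ and $H(1,x)=x_0$ for all $x\in X$. *)

(* Defs.v *)
From HB Require Import structures.
From mathcomp Require Import all_boot all_order all_algebra perm.
From mathcomp Require Import all_classical all_reals all_analysis.
From mathcomp Require Import complex.

Set Implicit Arguments.
Unset Strict Implicit.
Unset Printing Implicit Defensive.

Import Order.TTheory GRing.Theory Num.Theory.
Import numFieldNormedType.Exports.

Local Open Scope classical_set_scope.
Local Open Scope ring_scope.

(* Bundling R[i] as a numClosedFieldType gives it the topology of its norm and
   its structure of normed module over itself. *)
Definition Cplx (R : realType) : numClosedFieldType := R[i].

Definition polydisc (R : realType) (d : nat) : set 'rV[Cplx R]_d :=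
  [set z | forall i, `|z ord0 i| < 1].

Definition closed_polydisc (R : realType) (d : nat) : set 'rV[Cplx R]_d :=
  [set z | forall i, `|z ord0 i| <= 1].

Lemma closed_polydisc0 (R : realType) (d : nat) :
  (0 : 'rV[Cplx R]_d) \in @closed_polydisc R d.
Proof. by rewrite inE => i; rewrite mxE normr0 ler01. Qed.

HB.instance Definition _ (R : realType) (d : nat) :=
  isPointed.Build (@closed_polydisc R d) (exist _ 0 (closed_polydisc0 R d)).

Lemma closed_polydisc_perm (R : realType) (d : nat) (s : 'S_d)
    (z : 'rV[Cplx R]_d) :
  z \in @closed_polydisc R d -> col_perm s z \in @closed_polydisc R d.
Proof. by rewrite !inE => zD i; rewrite mxE; exact: zD. Qed.

Definition perm_closed_polydisc (R : realType) (d : nat) (s : 'S_d)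
    (z : @closed_polydisc R d) : @closed_polydisc R d :=
  exist _ (col_perm s (val z)) (closed_polydisc_perm s (valP z)).

(* [valL_ 0 f] extends f by 0 outside the closed polydisc; as the polydisc is
   open, its differentiability at a point of the polydisc (over the scalar
   field C, hence in the complex sense) depends on f only. *)
Definition holomorphic_polydisc (R : realType) (d : nat)
    (f : @closed_polydisc R d -> Cplx R) :=
  forall z, polydisc z ->
    differentiable ('valL_ 0 f : 'rV[Cplx R]_d -> Cplx R) z.

Definition polydisc_algebra (R : realType) (d : nat) :
    set (@closed_polydisc R d -> Cplx R) :=
  [set f | holomorphic_polydisc f /\ continuous f].

Definition symmetric_polydisc (R : realType) (d : nat)
    (f : @closed_polydisc R d -> Cplx R) :=
  forall z : @closed_polydisc R d, polydisc (val z) ->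
    forall s : 'S_d, f (perm_closed_polydisc s z) = f z.

Definition sym_polydisc_algebra (R : realType) (d : nat) :
    {pred (@closed_polydisc R d -> Cplx R)} :=
  mem [set f | @polydisc_algebra R d f /\ symmetric_polydisc f].

Lemma valL0E (R : realType) (d : nat) (f : @closed_polydisc R d -> Cplx R)
    (z : 'rV[Cplx R]_d) (zD : z \in @closed_polydisc R d) :
  'valL_ 0 f z = f (exist _ z zD).
Proof. by rewrite -[in RHS](valLK 0 f). Qed.

Lemma polydisc_closed (R : realType) (d : nat) (z : 'rV[Cplx R]_d) :
  polydisc z -> z \in @closed_polydisc R d.
Proof. by rewrite inE => zD i; exact/ltW/zD. Qed.

Lemma open_polydisc (R : realType) (d : nat) : open (@polydisc R d).
Proof.
rewrite openE => z zD.
suff H (i : 'I_d) : nbhs z [set w : 'rV[Cplx R]_d | `|w ord0 i| < 1].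
  exact: filter_forall H.
have e0 : 0 < 1 - `|z ord0 i| by rewrite subr_gt0 zD.
have := @coord_continuous (Cplx R) 1 d ord0 i z.
move=> /(cvgr_dist_lt (V := Cplx R)) /(_ _ e0); apply: filterS => w.
rewrite distrC ltrBrDr => h.
by apply: le_lt_trans h; rewrite -lerBlDr lerB_dist.
Qed.

Lemma differentiable_near_cst (K : numFieldType) (V W : normedModType K)
    (f : V -> W) (a : W) (x : V) :
  (\forall y \near x, f y = a) -> differentiable f x.
Proof.
move=> fa; have fxa := nbhs_singleton fa.
have df0 : f \o shift x = cst (f x) + (\0 : {linear V -> W}) +o_ 0 id.
  apply/eqaddoP => _/posnumP[e].
  have : \forall h \near (0 : V), f (h + x) = a.
    by move: fa; rewrite (near_shift 0) subr0.
  apply: filterS => h fha.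
  by rewrite !fctE /= fha fxa addr0 subrr normr0 mulr_ge0.
have c0 : continuous (\0 : {linear V -> W}) by move=> y; exact: cvg_cst.
by apply/diff_locallyP; rewrite (diff_unique c0 df0).
Qed.

Lemma sym_polydisc_algebra_cst (R : realType) (d : nat) (a : Cplx R) :
  cst a \in @sym_polydisc_algebra R d.
Proof.
rewrite inE; split; last by [].
split; last by move=> z; exact: cst_continuous.
move=> z zD; apply: (@differentiable_near_cst _ _ _ _ a).
have : \forall w \near z, polydisc w by move: zD; apply: open_polydisc.
by apply: filterS => w /polydisc_closed wD; rewrite (valL0E _ wD).
Qed.

Lemma sym_polydisc_algebraD (R : realType) (d : nat)
    (f g : @closed_polydisc R d -> Cplx R) :
  f \in @sym_polydisc_algebra R d -> g \in @sym_polydisc_algebra R d ->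
  f + g \in @sym_polydisc_algebra R d.
Proof.
rewrite !inE => -[[hf cf] sf] [[hg cg] sg]; split; last first.
  by move=> z zD s; rewrite !fctE sf ?sg.
split; last by move=> z; exact: (cvgD (V := Cplx R) (cf z) (cg z)).
move=> z zD.
have -> : 'valL_ 0 (f + g) = 'valL_ 0 f + 'valL_ 0 g :> (_ -> Cplx R).
  by apply/funext => w; rewrite !fctE /valL_/=; case: ('oinv_set_val w) => //=;
    rewrite addr0.
by apply: differentiableD; [exact: hf|exact: hg].
Qed.

Lemma sym_polydisc_algebraM (R : realType) (d : nat)
    (f g : @closed_polydisc R d -> Cplx R) :
  f \in @sym_polydisc_algebra R d -> g \in @sym_polydisc_algebra R d ->
  f * g \in @sym_polydisc_algebra R d.
Proof.
rewrite !inE => -[[hf cf] sf] [[hg cg] sg]; split; last first.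
  by move=> z zD s; rewrite !fctE sf ?sg.
split; last by move=> z; exact: (cvgM (K := Cplx R) (cf z) (cg z)).
move=> z zD.
have -> : 'valL_ 0 (f * g) = 'valL_ 0 f * 'valL_ 0 g :> (_ -> Cplx R).
  by apply/funext => w; rewrite !fctE /valL_/=; case: ('oinv_set_val w) => //=;
    rewrite mulr0.
by apply: differentiableM; [exact: hf|exact: hg].
Qed.

Lemma sym_polydisc_algebra_subring (R : realType) (d : nat) :
  subring_closed (@sym_polydisc_algebra R d).
Proof.
split=> [|f g fA gA|f g]; first exact: sym_polydisc_algebra_cst.
  apply: sym_polydisc_algebraD => //.
  have -> : - g = cst (-1) * g.
    by apply/funext => z; rewrite !fctE mulN1r.
  by apply: sym_polydisc_algebraM => //; exact: sym_polydisc_algebra_cst.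
exact: sym_polydisc_algebraM.
Qed.

Lemma sym_polydisc_algebra_submod (R : realType) (d : nat) :
  subsemimod_closed (@sym_polydisc_algebra R d).
Proof.
split; last first.
  move=> a f fA; have -> : a *: f = cst a * f by [].
  by apply: sym_polydisc_algebraM => //; exact: sym_polydisc_algebra_cst.
split; first exact: sym_polydisc_algebra_cst.
by move=> f g; exact: sym_polydisc_algebraD.
Qed.

Definition Asym (R : realType) (d : nat) : Type :=
  {f : @closed_polydisc R d -> Cplx R | f \in @sym_polydisc_algebra R d}.

HB.instance Definition _ (R : realType) (d : nat) :=
  [isSub of Asym R d for @sval _ _].
HB.instance Definition _ (R : realType) (d : nat) :=
  [Choice of Asym R d by <:].
HB.instance Definition _ (R : realType) (d : nat) :=
  GRing.SubChoice_isSubComPzRing.Build _ _ (Asym R d)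
    (@sym_polydisc_algebra_subring R d).
HB.instance Definition _ (R : realType) (d : nat) :=
  GRing.SubZmodule_isSubLmodule.Build _ _ _ (Asym R d)
    (@sym_polydisc_algebra_submod R d).

Lemma Asym_oner_neq0 (R : realType) (d : nat) : 1 != 0 :> Asym R d.
Proof.
apply/eqP => /(congr1 val) /(congr1 (@^~ point)) /eqP.
by rewrite oner_eq0.
Qed.

HB.instance Definition _ (R : realType) (d : nat) :=
  GRing.PzSemiRing_isNonZero.Build (Asym R d) (@Asym_oner_neq0 R d).

Lemma Asym_scalerAl (R : realType) (d : nat) (a : Cplx R) (f g : Asym R d) :
  a *: (f * g) = a *: f * g.
Proof. by apply/val_inj/funext => z; exact: mulrA. Qed.

HB.instance Definition _ (R : realType) (d : nat) :=
  GRing.Lmodule_isLalgebra.Build (Cplx R) (Asym R d) (@Asym_scalerAl R d).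
HB.instance Definition _ (R : realType) (d : nat) :=
  GRing.Lalgebra_isComAlgebra.Build (Cplx R) (Asym R d).

Definition complex_homomorphism (R : realType) (A : comAlgType (Cplx R))
    (phi : A -> Cplx R) :=
  (forall (a : Cplx R) (f g : A), phi (a *: f + g) = a * phi f + phi g) /\
  (forall f g : A, phi (f * g) = phi f * phi g).

(* The weak-* topology of a dual space is the topology of pointwise convergence,
   i.e. the one induced by {ptws A -> C}. Complex homomorphisms of a Banach
   algebra A are automatically continuous, so the Gelfand topology on them is
   the subspace topology inherited from {ptws A -> C}; it does not refer to the
   norm of A. *)
Definition max_ideal_space (R : realType) (A : comAlgType (Cplx R)) :
    topologicalType :=
  set_type [set phi : {ptws A -> Cplx R} |
    complex_homomorphism phi /\ exists f, phi f != 0].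

Definition contractible (R : realType) (X : topologicalType) :=
  exists (x0 : X) (H : (`[0, 1]%classic : set R) * X -> X),
    continuous H /\
    forall (t : (`[0, 1]%classic : set R)) (x : X),
      (val t = 0 -> H (t, x) = x) /\ (val t = 1 -> H (t, x) = x0).

(* Main.v *)
Require Import Defs.
From mathcomp Require Import all_boot all_order all_algebra perm.
From mathcomp Require Import all_classical all_reals all_analysis.
From mathcomp Require Import complex.

Set Implicit Arguments.
Unset Strict Implicit.
Unset Printing Implicit Defensive.

Import Order.TTheory GRing.Theory Num.Theory.
Import numFieldNormedType.Exports.

Local Open Scope classical_set_scope.
Local Open Scope ring_scope.

(** The contraction comes from the dilations [z |-> r z] of the closed polydisc,
    for [0 <= r <= 1].  They commute with the permutations of the coordinates,
    so [f_r(z) = f(r z)] defines an algebra endomorphism [f |-> f_r] of the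
    symmetric polydisc algebra ([dilate]), and [phi |-> (f |-> phi(f_r))] is a
    selfmap of its maximal ideal space.  With [r = 1 - t] this is the identity at
    [t = 0], and at [t = 1] it sends every [phi] to the evaluation at the origin,
    because [f_0] is the constant [f(0)].

    Joint continuity in [(t, phi)] means that [phi(f_r)] is close to
    [phi0(f_r0)] when [phi] is close to [phi0] and [r] to [r0].  Write
      [phi0(f_r0) - phi(f_r) = (phi0(f_r0) - phi(f_r0)) + phi(f_r0 - f_r)].
    The first difference is small by the definition of the Gelfand topology.
    The second is small, uniformly in [phi], by two facts:
    - a character takes at [g] one of the values of the function [g]
      ([complex_homomorphism_value]), for otherwise [g - phi(g)] would be
      invertible in the algebra; so it is bounded by the sup norm of [g];
    - [f_r] tends to [f_r0] uniformly as [r] tends to [r0] ([near_dilate]), since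
      the closed polydisc is compact. *)

(** * Compactness of the closed polydisc *)

Lemma complex_normE (R : realType) (x : R) :
  `|real_complex R x : Cplx R| = real_complex R `|x|.
Proof. by rewrite [LHS]normc_def /= expr0n addr0 sqrtr_sqr. Qed.

Lemma continuous_real_complex (R : realType) :
  continuous (real_complex R : R -> Cplx R).
Proof.
move=> x; apply/(@cvgrPdist_lt _ (Cplx R)) => -[e e'].
rewrite ltcE /= => /andP[/eqP-> e0].
have := @cvg_id _ (nbhs x); move/(@cvgrPdist_lt _ R^o)/(_ _ e0).
apply: filterS => y /= h.
by rewrite -rmorphB complex_normE ltcR.
Qed.

(** The disc is a closed part of the image of a real square under
    [(x, y) |-> x + i y]. *)
Lemma compact_closed_disc (R : realType) : compact [set z : Cplx R | `|z| <= 1].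
Proof.
pose F (p : R * R) : Cplx R :=
  real_complex R p.1 + real_complex R p.2 * ('i%C : Cplx R).
have cF : continuous F.
  move=> p; apply: (@cvgD _ (Cplx R)).
    apply: (@cvg_comp _ _ _ fst (real_complex R : R -> Cplx R)).
      exact: cvg_fst.
    exact: continuous_real_complex.
  apply: (@cvgM (Cplx R)); last exact: cvg_cst.
  apply: (@cvg_comp _ _ _ snd (real_complex R : R -> Cplx R)).
    exact: cvg_snd.
  exact: continuous_real_complex.
have cK : compact (F @` (`[-1, 1] `*` `[-1, 1])).
  apply: continuous_compact; first exact/continuous_subspaceT.
  by apply: compact_setX; exact: segment_compact.
apply: (subclosed_compact _ cK).
  rewrite -[X in closed X]setCK; apply: open_closedC; rewrite openE => z /negP.
  rewrite -real_ltNge ?real1 ?normr_real //= => z1.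
  have e0 : 0 < `|z| - 1 by rewrite subr_gt0.
  have := @cvg_id _ (nbhs z); move/(@cvgrPdist_lt _ (Cplx R))/(_ _ e0).
  apply: filterS => w /= zw; apply/negP.
  rewrite -real_ltNge ?real1 ?normr_real // -[1](subKr `|z|) ltrBlDr -ltrBlDl.
  by apply: le_lt_trans zw; rewrite lerB_dist.
case=> x y /= z1; exists (x, y) => /=; last first.
  rewrite /F /=; apply/eqP; rewrite eq_complex /=.
  by apply/andP; split; apply/eqP; simpc.
have : x ^+ 2 + y ^+ 2 <= 1.
  move: z1; rewrite normc_def lecR /= -[X in _ <= X]sqrtr1.
  by rewrite ler_sqrt.
move=> h.
have x2 : x ^+ 2 <= 1 by apply: le_trans h; rewrite lerDl sqr_ge0.
have y2 : y ^+ 2 <= 1 by apply: le_trans h; rewrite lerDr sqr_ge0.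
by split; rewrite /= in_itv /= -ler_norml -(@expr_le1 _ 2) ?real_normK ?num_real.
Qed.

Lemma compact_closed_polydisc (R : realType) (d : nat) :
  compact (@closed_polydisc R d).
Proof.
exact: (@rV_compact (Cplx R) d (fun=> [set z : Cplx R | `|z| <= 1])
  (fun=> @compact_closed_disc R)).
Qed.

(** * Characters of the symmetric polydisc algebra *)

Lemma sym_polydisc_algebraV (R : realType) (d : nat)
    (f : @closed_polydisc R d -> Cplx R) :
  (forall z, f z != 0) ->
  f \in @sym_polydisc_algebra R d ->
  (fun z => (f z)^-1) \in @sym_polydisc_algebra R d.
Proof.
move=> f0; rewrite !inE => -[[hf cf] sf]; split; last first.
  by move=> z zD s; rewrite /= sf.
split; last by move=> z; exact: (cvgV (K := Cplx R) (f0 z) (cf z)).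
move=> z zD.
have -> : 'valL_ 0 (fun z => (f z)^-1) = (fun w => ('valL_ 0 f w)^-1).
  apply/funext => w; rewrite /valL_ /=; case: ('oinv_set_val w) => //=.
  by rewrite invr0.
apply: differentiableV; first exact: hf.
by rewrite (valL0E _ (polydisc_closed zD)).
Qed.

Lemma complex_homomorphism1 (R : realType) (A : comAlgType (Cplx R))
    (phi : A -> Cplx R) :
  complex_homomorphism phi -> (exists f, phi f != 0) -> phi 1 = 1.
Proof.
move=> [_ phiM] [f f0]; apply: (mulIf f0).
by rewrite mul1r -phiM mul1r.
Qed.

Lemma complex_homomorphismB (R : realType) (A : comAlgType (Cplx R))
    (phi : A -> Cplx R) (f g : A) :
  complex_homomorphism phi -> phi (f - g) = phi f - phi g.
Proof. by move=> [phiL _]; rewrite addrC -scaleN1r phiL mulN1r addrC. Qed.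

Lemma complex_homomorphism_cst (R : realType) (A : comAlgType (Cplx R))
    (phi : A -> Cplx R) (a : Cplx R) :
  complex_homomorphism phi -> (exists f, phi f != 0) -> phi (a *: 1) = a.
Proof.
move=> hphi phi0; have [phiL _] := hphi.
have phi00 : phi 0 = 0 by rewrite -(subrr 0) complex_homomorphismB // subrr.
rewrite -[a *: 1]addr0 phiL phi00 addr0.
by rewrite (complex_homomorphism1 hphi phi0) mulr1.
Qed.

(** If [phi f] were not a value of [f], then [f - phi f] would have no zero on the
    closed polydisc, and its pointwise inverse would again be in the algebra; but
    [phi] maps [f - phi f] to 0.  In particular [phi] is bounded by the sup norm. *)
Lemma complex_homomorphism_value (R : realType) (d : nat)
    (phi : Asym R d -> Cplx R) (f : Asym R d) :
  complex_homomorphism phi -> (exists g, phi g != 0) ->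
  exists z, phi f = val f z.
Proof.
move=> hphi phi0; have phi1 := complex_homomorphism1 hphi phi0.
have [phiL phiM] := hphi; apply: contrapT => /forallNP nf.
pose g : Asym R d := (- phi f) *: 1 + f.
have g0 z : val g z != 0.
  apply/eqP => gz; apply: (nf z).
  have : val g z = - phi f * 1 + val f z by [].
  by rewrite gz mulr1 => /esym/eqP; rewrite addrC subr_eq0 => /eqP.
pose h : Asym R d := exist (fun f => f \in @sym_polydisc_algebra R d) _
  (sym_polydisc_algebraV g0 (valP g)).
have gh : g * h = 1.
  by apply/val_inj/funext => z; exact: mulfV (g0 z).
have /eqP := phi1; rewrite -gh phiM phiL phi1 mulr1 addNr mul0r.
by rewrite eq_sym oner_eq0.
Qed.

(** * Dilations *)

Lemma closed_polydisc_scale (R : realType) (d : nat) (c : Cplx R)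
    (z : 'rV[Cplx R]_d) :
  `|c| <= 1 -> z \in @closed_polydisc R d -> c *: z \in @closed_polydisc R d.
Proof.
rewrite !inE => c1 zD i; rewrite mxE normrM.
by apply: mulr_ile1 => //; exact: zD.
Qed.

Definition scale_closed_polydisc (R : realType) (d : nat) (c : Cplx R)
    (c1 : `|c| <= 1) (z : @closed_polydisc R d) : @closed_polydisc R d :=
  exist (fun w => w \in @closed_polydisc R d) (c *: val z)
    (closed_polydisc_scale c1 (valP z)).

Lemma continuous_scale_closed_polydisc (R : realType) (d : nat) (c : Cplx R)
    (c1 : `|c| <= 1) : continuous (@scale_closed_polydisc R d c c1).
Proof.
apply: (@continuous_comp_initial _ _ _ set_val) => z.
apply: (@cvg_comp _ _ _ val (fun w : 'rV[Cplx R]_d => c *: w)).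
  exact: initial_continuous.
exact: scaler_continuous.
Qed.

Lemma near_eq_differentiable (K : numFieldType) (V W : normedModType K)
    (f g : V -> W) (x : V) :
  (\forall y \near x, f y = g y) -> differentiable g x -> differentiable f x.
Proof.
move=> fg dg; rewrite -(subrK g f); apply: differentiableD => //.
apply: (@differentiable_near_cst _ _ _ _ 0); apply: filterS fg => y fgy.
by rewrite !fctE fgy subrr.
Qed.

Lemma sym_polydisc_algebra_dilate (R : realType) (d : nat) (c : Cplx R)
    (c1 : `|c| <= 1) (f : @closed_polydisc R d -> Cplx R) :
  f \in @sym_polydisc_algebra R d ->
  f \o scale_closed_polydisc c1 \in @sym_polydisc_algebra R d.
Proof.
rewrite !inE => -[[hf cf] sf].
have scaleD (z : 'rV[Cplx R]_d) : polydisc z -> polydisc (c *: z).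
  move=> zD i; rewrite mxE normrM.
  by apply: le_lt_trans (zD i); rewrite ler_piMl.
split; last first.
  move=> z zD s /=; rewrite -(sf (scale_closed_polydisc c1 z) (scaleD _ zD) s).
  by congr f; apply: val_inj; apply/rowP => i; rewrite !mxE.
split; last first.
  move=> z; apply: continuous_comp; last exact: cf.
  exact: continuous_scale_closed_polydisc.
move=> z zD.
(* The extension by 0 of the dilated function agrees with the dilated extension
   only inside the closed polydisc, hence the local comparison. *)
apply: (@near_eq_differentiable _ _ _ _ ('valL_ 0 f \o *:%R c)).
  have : \forall w \near z, polydisc w by move: zD; apply: open_polydisc.
  apply: filterS => w /polydisc_closed wD; rewrite (valL0E _ wD).
  rewrite [RHS](valL0E _ (closed_polydisc_scale c1 wD)).
  by congr f; exact: val_inj.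
apply: differentiable_comp; last exact/hf/scaleD.
by apply: linear_differentiable; exact: scaler_continuous.
Qed.

Definition dilate (R : realType) (d : nat) (c : Cplx R) (c1 : `|c| <= 1)
    (f : Asym R d) : Asym R d :=
  exist (fun f => f \in @sym_polydisc_algebra R d)
    (val f \o scale_closed_polydisc c1)
    (sym_polydisc_algebra_dilate c1 (valP f)).

(** Joint continuity of [(c, z) |-> f (c z)] gives the bound for [z] near a given
    point and [c] near [c0]; compactness of the closed polydisc makes the
    neighbourhood of [c0] independent of [z]. *)
Lemma near_dilate (R : realType) (d : nat) (f : Asym R d) (c0 : Cplx R)
    (c01 : `|c0| <= 1) (e : Cplx R) : 0 < e ->
  \forall c \near c0, forall (c1 : `|c| <= 1) z,
    `|val (dilate c01 f) z - val (dilate c1 f) z| < e.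
Proof.
move=> e0; pose g := 'valL_ 0 (val f) : 'rV[Cplx R]_d -> Cplx R.
have cg : {within @closed_polydisc R d, continuous g}.
  apply/subspace_valL_continuousP'.
  by have := valP f; rewrite inE => -[[]].
have /compact_near_coveringP/near_covering_withinP cov :=
  @compact_closed_polydisc R d.
have := cov _ (nbhs c0)
  (fun c z => `|c| <= 1 -> `|g (c0 *: z) - g (c *: z)| < e) _.
have H (z : 'rV[Cplx R]_d) : closed_polydisc z ->
  \forall z' \near z & c \near c0, closed_polydisc z' ->
    `|c| <= 1 -> `|g (c0 *: z') - g (c *: z')| < e.
  move=> zD.
  have w0D : closed_polydisc (c0 *: z).
    by apply/set_mem/closed_polydisc_scale => //; exact/mem_set.
  have e20 : 0 < e / 2 by rewrite divr_gt0.
  have near_g : \forall w \near c0 *: z, closed_polydisc w ->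
      `|g (c0 *: z) - g w| < e / 2.
    have /(@cvgrPdist_lt _ (Cplx R))/(_ _ e20) := cg (c0 *: z).
    move=> h; change (within (@closed_polydisc R d) (nbhs (c0 *: z))
      [set w | `|g (c0 *: z) - g w| < e / 2]).
    by rewrite (nbhs_subspace_in w0D); exact: h.
  have n1 : \forall z' \near z & c \near c0, closed_polydisc (c *: z') ->
      `|g (c0 *: z) - g (c *: z')| < e / 2.
    have sc := @scale_continuous (Cplx R) 'rV[Cplx R]_d (c0, z).
    have h : (fun p => p.2 *: p.1) @ (filter_prod (nbhs z) (nbhs c0))
        --> c0 *: z.
      exact: (cvg_comp2 (@cvg_snd _ _ (nbhs z) (nbhs c0) _)
        (@cvg_fst _ _ (nbhs z) (nbhs c0) _) sc).
    exact: h near_g.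
  have n2 : \forall z' \near z & c \near c0, closed_polydisc (c0 *: z') ->
      `|g (c0 *: z) - g (c0 *: z')| < e / 2.
    have sc := @scaler_continuous (Cplx R) 'rV[Cplx R]_d c0 z.
    have h : (fun p => c0 *: p.1) @ (filter_prod (nbhs z) (nbhs c0))
        --> c0 *: z.
      exact: (cvg_comp _ _ (@cvg_fst _ _ (nbhs z) (nbhs c0) _) sc).
    exact: h near_g.
  apply: filterS2 n1 n2 => -[z' c] /= h1 h2 z'D c1.
  rewrite (splitr e) -(subrKA (g (c0 *: z))).
  apply: le_lt_trans (ler_normD _ _) _; apply: ltrD.
    by rewrite distrC; apply/h2/set_mem/closed_polydisc_scale => //; exact/mem_set.
  by apply/h1/set_mem/closed_polydisc_scale => //; exact/mem_set.
move=> /(_ _ H); apply: filterS => c hc c1 z.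
have := hc (val z) (set_mem (valP z)) c1.
have := closed_polydisc_scale c1 (valP z).
have := closed_polydisc_scale c01 (valP z).
move=> h1 h2; rewrite /g (valL0E _ h1) (valL0E _ h2) /=.
by congr (`|val f _ - val f _| < _); exact: val_inj.
Qed.

Lemma dilate1 (R : realType) (d : nat) (c : Cplx R) (c1 : `|c| <= 1)
  (f : Asym R d) : c = 1 -> dilate c1 f = f.
Proof.
move=> cE; apply/val_inj/funext => z /=; congr (val f _).
by apply: val_inj; rewrite /= cE scale1r.
Qed.

Lemma dilate0 (R : realType) (d : nat) (c : Cplx R) (c1 : `|c| <= 1)
  (f : Asym R d) : c = 0 -> dilate c1 f = val f point *: 1.
Proof.
move=> cE; apply/val_inj/funext => z.
have -> : val (val f point *: (1 : Asym R d)) z = val f point * 1 by [].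
rewrite mulr1 /=; congr (val f _).
by apply: val_inj; rewrite /= cE scale0r.
Qed.

(** * The maximal ideal space *)

Lemma complex_homomorphism_dilate (R : realType) (d : nat) (c : Cplx R)
    (c1 : `|c| <= 1) (phi : Asym R d -> Cplx R) :
  complex_homomorphism phi /\ (exists f, phi f != 0) ->
  complex_homomorphism (phi \o dilate c1) /\
    exists f, (phi \o dilate c1) f != 0.
Proof.
move=> [hphi phi0]; have phi1 := complex_homomorphism1 hphi phi0.
have [phiL phiM] := hphi; split; first split.
- by move=> a f g /=; rewrite -phiL; congr phi; exact: val_inj.
- by move=> f g /=; rewrite -phiM; congr phi; exact: val_inj.
exists 1 => /=; have -> : dilate c1 (1 : Asym R d) = 1 by exact: val_inj.
by rewrite phi1 oner_eq0.
Qed.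

Definition max_ideal_dilate (R : realType) (d : nat) (c : Cplx R)
    (c1 : `|c| <= 1) (phi : max_ideal_space (Asym R d)) :
    max_ideal_space (Asym R d) :=
  exist _ (val phi \o dilate c1 : {ptws Asym R d -> Cplx R})
    (mem_set (complex_homomorphism_dilate c1 (set_mem (valP phi)))).

Lemma complex_homomorphism_eval (R : realType) (d : nat)
    (z : @closed_polydisc R d) :
  complex_homomorphism (fun f : Asym R d => val f z) /\
  exists f : Asym R d, val f z != 0.
Proof. by split; [split|exists 1; exact: oner_neq0]. Qed.

Definition max_ideal_at (R : realType) (d : nat) (z : @closed_polydisc R d) :
    max_ideal_space (Asym R d) :=
  exist _ ((fun f => val f z) : {ptws Asym R d -> Cplx R})
    (mem_set (complex_homomorphism_eval z)).

Lemma continuous_max_ideal_space (R : realType) (A : comAlgType (Cplx R))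
    (T : topologicalType) (F : T -> max_ideal_space A) :
  (forall f, continuous (fun t => val (F t) f : Cplx R)) -> continuous F.
Proof.
move=> cF; apply: (@continuous_comp_initial _ _ _ set_val) => t.
apply/cvg_sup => f U [_ [[W oW <-] Wt]] WU.
by apply: filterS WU _; apply: (cF f t); exact: open_nbhs_nbhs.
Qed.

Lemma continuous_max_ideal_eval (R : realType) (A : comAlgType (Cplx R))
    (f : A) : continuous (fun phi : max_ideal_space A => val phi f : Cplx R).
Proof.
pose B : set {ptws A -> Cplx R} :=
  [set phi | complex_homomorphism phi /\ exists f, phi f != 0].
move=> phi W Wphi.
have : nbhs (set_val phi : {ptws A -> Cplx R})
    ((fun g : {ptws A -> Cplx R} => g f) @^-1` W).
  have /cvg_sup/(_ f) h : nbhs (set_val phi : {ptws A -> Cplx R}) -->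
    (set_val phi : {ptws A -> Cplx R}) by exact: cvg_id.
  apply: h.
  exact: (@initial_continuous _ _ (fun g : A -> Cplx R => g f)).
exact: (@initial_continuous B _ set_val phi).
Qed.

Lemma itv01_complex_norm_le1 (R : realType) (t : `[0, 1]%classic : set R) :
  `|real_complex R (1 - val t) : Cplx R| <= 1.
Proof.
have := set_mem (valP t); rewrite /= in_itv /= => /andP[t0 t1].
rewrite complex_normE -(rmorph1 (real_complex R)) lecR ler_norml.
apply/andP; split.
  by rewrite lerBrDr addrC lerBlDr (le_trans t1) // lerDl.
by rewrite gerBl.
Qed.

Theorem theorem4p1 (R : realType) (d : nat) (d_gt0 : (0 < d)%N) :
  contractible R (max_ideal_space (Asym R d)).
Proof.
(* [point] is the origin, the common image of the dilation of ratio 0. *)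
exists (@max_ideal_at R d point).
exists (fun p => max_ideal_dilate (itv01_complex_norm_le1 p.1) p.2).
split; last first.
  move=> t phi; split=> tE; apply/val_inj/funext => f /=.
    by rewrite dilate1 // tE subr0.
  rewrite dilate0; last by rewrite tE subrr.
  have [hphi phi0] := set_mem (valP phi).
  exact: complex_homomorphism_cst.
apply: continuous_max_ideal_space => f [t0 phi0].
apply/(@cvgrPdist_lt _ (Cplx R)) => e e0.
have e20 : 0 < e / 2 by rewrite divr_gt0.
pose f0 := dilate (itv01_complex_norm_le1 t0) f.
have near_phi : \forall p \near (t0, phi0), `|val phi0 f0 - val p.2 f0| < e / 2.
  have h : (fun p : (`[0, 1]%classic : set R) * max_ideal_space (Asym R d) =>
      val p.2 f0 : Cplx R) @ (t0, phi0) --> (val phi0 f0 : Cplx R).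
    apply: (@cvg_comp _ _ _ snd
      (fun phi : max_ideal_space (Asym R d) => val phi f0 : Cplx R)).
      exact: cvg_snd.
    exact: continuous_max_ideal_eval.
  by move/(@cvgrPdist_lt _ (Cplx R))/(_ _ e20) : h.
have near_t : \forall p \near (t0, phi0),
    forall (c1 : `|real_complex R (1 - val p.1) : Cplx R| <= 1) z,
    `|val f0 z - val (dilate c1 f) z| < e / 2.
  have h : (fun p : (`[0, 1]%classic : set R) * max_ideal_space (Asym R d) =>
      real_complex R (1 - val p.1) : Cplx R) @ (t0, phi0) -->
      (real_complex R (1 - val t0) : Cplx R).
    apply: (@cvg_comp _ _ _ fst
      (fun t : (`[0, 1]%classic : set R) => real_complex R (1 - val t) : Cplx R)).
      exact: cvg_fst.
    apply: (@cvg_comp _ _ _ (fun t => 1 - val t) (real_complex R : R -> Cplx R)).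
      apply: (@cvgB _ R^o); first exact: cvg_cst.
      exact: initial_continuous.
    exact: continuous_real_complex.
  exact: (h _ (near_dilate f (itv01_complex_norm_le1 t0) e20)).
apply: filterS2 near_phi near_t => -[t phi] /= h1 h2.
rewrite (splitr e) -(subrKA (val phi f0)).
apply: le_lt_trans (ler_normD _ _) _; apply: ltrD; first exact: h1.
have [hphi phiN] := set_mem (valP phi).
rewrite -(complex_homomorphismB _ _ hphi).
have [z ->] := complex_homomorphism_value
  (f0 - dilate (itv01_complex_norm_le1 t) f) hphi phiN.
exact: h2.
Qed.
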